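(* Let $D\subseteq\mathbb{B}^2$ be a Lebesgue-measurable set with $0<\Lambda(D)<+\infty$. If $c$ is the conformal barycenter of $D$, then $g(c)$ is the conformal barycenter of $g(D)$ for any Möbius transformation $g\in G_+$.
   Context: $\mathbb{B}^2=\{z\in\mathbb{C}: |z|<1\}$ is the open unit disc. $G_+$ is the group of orientation-preserving conformal automorphisms of $\mathbb{B}^2$, i.e. the maps $z\mapsto e^{i\theta}\frac{a-z}{1-\bar a z}$ with $\theta\in[0,2\pi)$, $a\in\mathbb{B}^2$. The hyperbolic measure on $\mathbb{B}^2$ is $d\Lambda(z)=\frac{d\lambda(z)}{(1-|z|^2)^2}$, where $\lambda$ is Lebesgue measure on $\mathbb{C}$. For a Lebesgue-measurable set $D\subseteq\mathbb{B}^2$ with $0<\Lambda(D)<+\infty$, the conformal barycenter of $D$ is the unique point $c\in\mathbb{B}^2$ such that $\int_D \frac{c-z}{1-\bar c z}\, d\Lambda(z)=0$. *)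

(* Defs.v *)
From HB Require Import structures.
From mathcomp Require Import all_boot all_order all_algebra.
From mathcomp Require Import complex.
From mathcomp Require Import all_classical all_reals all_analysis.
From mathcomp Require Import measurable_realfun.

Set Implicit Arguments.
Unset Strict Implicit.
Unset Printing Implicit Defensive.

Import Order.TTheory GRing.Theory Num.Theory.
Import numFieldNormedType.Exports.
Import Normc.

Local Open Scope classical_set_scope.
Local Open Scope ring_scope.
Local Open Scope complex_scope.

(* The measurable sets here are the Caratheodory-measurable ones, that is, all
   Lebesgue-measurable subsets of R^2 and not only the Borel sets. *)
Definition lebesgue_measure2 {R : realType} :=
  @completed_measure_extension _ _ _
    (@lebesgue_measure R \x @lebesgue_measure R)%E.
HB.instance Definition _ (R : realType) := Measure.on (@lebesgue_measure2 R).

Notation lebesgueR2 R :=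
  (caratheodory_type (mu_ext (@lebesgue_measure R \x @lebesgue_measure R)%E)).

Definition complex_of_pair {R : realType} (p : lebesgueR2 R) : R[i] :=
  p.1 +i* p.2.

(* A copy of R[i] that carries the sigma-algebra of Lebesgue-measurable sets,
   transported from R^2; it is convertible to R[i]. *)
Definition lebesgueC (R : realType) : Type := R[i].

Section lebesgueC_measurable.
Context {R : realType}.

HB.instance Definition _ := Choice.on (lebesgueC R).
HB.instance Definition _ := isPointed.Build (lebesgueC R) (0 : R[i]).

Let lmeas : set_system (lebesgueC R) :=
  [set A | measurable (@complex_of_pair R @^-1` A)].

Let lmeas0 : lmeas set0.
Proof. by rewrite /lmeas /= preimage_set0. Qed.

Let lmeasC A : lmeas A -> lmeas (~` A).
Proof. by rewrite /lmeas /= preimage_setC; exact: measurableC. Qed.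

Let lmeas_bigcup (F : (set (lebesgueC R))^nat) :
  (forall i, lmeas (F i)) -> lmeas (\bigcup_i F i).
Proof. by rewrite /lmeas /= preimage_bigcup; exact: bigcupT_measurable. Qed.

HB.instance Definition _ := @isMeasurable.Build default_measure_display
  (lebesgueC R) lmeas lmeas0 lmeasC lmeas_bigcup.

End lebesgueC_measurable.

Lemma measurable_complex_of_pair (R : realType) :
  measurable_fun setT (@complex_of_pair R : lebesgueR2 R -> lebesgueC R).
Proof. by move=> _ A mA; rewrite setTI. Qed.

Definition lebesgue_measureC {R : realType} : set (lebesgueC R) -> \bar R :=
  pushforward (@lebesgue_measure2 R)
    (@complex_of_pair R : lebesgueR2 R -> lebesgueC R).

Section lebesgue_measureC_measure.
Context {R : realType}.
Local Open Scope ereal_scope.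

Let lebesgueC0 : @lebesgue_measureC R set0 = 0.
Proof. by rewrite /lebesgue_measureC /pushforward preimage_set0 measure0. Qed.

Let lebesgueC_ge0 A : 0 <= @lebesgue_measureC R A.
Proof. exact: (measure_ge0 (@lebesgue_measure2 R)). Qed.

Let lebesgueC_sigma_additive : semi_sigma_additive (@lebesgue_measureC R).
Proof.
move=> F mF tF mUF; rewrite /lebesgue_measureC /pushforward preimage_bigcup.
apply: (measure_semi_sigma_additive (s := @lebesgue_measure2 R)) => //.
- apply/trivIsetP => /= i j _ _ ij; rewrite -preimage_setI.
  by move/trivIsetP : tF => /(_ _ _ _ _ ij) ->//; rewrite preimage_set0.
Qed.

HB.instance Definition _ := isMeasure.Build _ _ _ (@lebesgue_measureC R)
  lebesgueC0 lebesgueC_ge0 lebesgueC_sigma_additive.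

End lebesgue_measureC_measure.

Definition unit_disc {R : realType} : set R[i] := [set z | normc z < 1].

Definition hyperbolic_density {R : realType} (z : R[i]) : R :=
  ((1 - normc z ^+ 2) ^+ 2)^-1.

Definition hyperbolic_measure {R : realType} : set (lebesgueC R) -> \bar R :=
  fun A => (\int[@lebesgue_measureC R]_(z in A `&` unit_disc)
              (hyperbolic_density z)%:E)%E.

Section hyperbolic_measure_measure.
Context {R : realType}.

Let ReC (z : lebesgueC R) : R := complex.Re z.
Let ImC (z : lebesgueC R) : R := complex.Im z.

Lemma measurable_ReC : measurable_fun setT ReC.
Proof.
move=> _ A mA; rewrite setTI; apply: sub_caratheodory.
apply: sub_sigma_algebra.
rewrite (_ : _ @^-1` _ = A `*` setT); last first.
  by apply/seteqP; split => [[x y]|[x y] []].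
exact: measurableX.
Qed.

Lemma measurable_ImC : measurable_fun setT ImC.
Proof.
move=> _ A mA; rewrite setTI; apply: sub_caratheodory.
apply: sub_sigma_algebra.
rewrite (_ : _ @^-1` _ = setT `*` A); last first.
  by apply/seteqP; split => [[x y]|[x y] []].
exact: measurableX.
Qed.

Lemma measurable_normc2 :
  measurable_fun setT (fun z : lebesgueC R => normc z ^+ 2).
Proof.
rewrite (_ : (fun _ => _) = fun z => ReC z ^+ 2 + ImC z ^+ 2); last first.
  by apply/funext => -[x y]; rewrite /normc sqr_sqrtr// addr_ge0// sqr_ge0.
apply: measurable_funD; apply: measurable_funX.
  exact: measurable_ReC.
exact: measurable_ImC.
Qed.

Lemma normc_ge0 (z : R[i]) : 0 <= normc z.
Proof. by case: z => x y; exact: sqrtr_ge0. Qed.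

Lemma measurable_unit_disc : measurable (unit_disc : set (lebesgueC R)).
Proof.
rewrite (_ : unit_disc = (fun z : lebesgueC R => normc z ^+ 2) @^-1` `]-oo, 1[).
  by rewrite -[X in measurable X]setTI; exact: measurable_normc2.
by apply/seteqP; split => z /=;
  rewrite /unit_disc/= in_itv/= expr_lt1// normc_ge0.
Qed.

Lemma measurable_hyperbolic_density :
  measurable_fun setT (hyperbolic_density : lebesgueC R -> R).
Proof.
rewrite (_ : hyperbolic_density = fun z => ((1 - normc z ^+ 2) ^+ 2) `^ (-1)).
  apply: (measurableT_comp (measurable_powR (-1))).
  apply: measurable_funX; apply: measurable_funB => //.
  exact: measurable_normc2.
by apply/funext => z; rewrite powR_inv1// sqr_ge0.
Qed.

Lemma hyperbolic_density_ge0 (z : R[i]) : 0 <= hyperbolic_density z.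
Proof. by rewrite invr_ge0 sqr_ge0. Qed.

Local Open Scope ereal_scope.

Let hyperbolic0 : @hyperbolic_measure R set0 = 0.
Proof. by rewrite /hyperbolic_measure set0I integral_set0. Qed.

Let hyperbolic_ge0 A : 0 <= @hyperbolic_measure R A.
Proof. by apply: integral_ge0 => z _; rewrite lee_fin hyperbolic_density_ge0. Qed.

Let hyperbolic_sigma_additive : semi_sigma_additive (@hyperbolic_measure R).
Proof.
move=> /= F mF tF mUF; rewrite /hyperbolic_measure; apply: cvg_toP.
  apply: ereal_nondecreasing_is_cvgn => m n mn.
  apply: lee_sum_nneg_natr => // k _ _; exact: hyperbolic_ge0.
rewrite setI_bigcupl ge0_integral_bigcup//=.
- by move=> k; apply: measurableI => //; exact: measurable_unit_disc.
- apply: measurable_funTS; apply: measurableT_comp => //.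
  exact: measurable_hyperbolic_density.
- by move=> z _; rewrite lee_fin hyperbolic_density_ge0.
- apply/trivIsetP => /= i j _ _ ij; rewrite setIACA.
  by move/trivIsetP : tF => /(_ _ _ _ _ ij) ->//; rewrite set0I.
Qed.

HB.instance Definition _ := isMeasure.Build _ _ _ (@hyperbolic_measure R)
  hyperbolic0 hyperbolic_ge0 hyperbolic_sigma_additive.

End hyperbolic_measure_measure.

Definition Cintegral d (T : measurableType d) (R : realType)
    (mu : {measure set T -> \bar R}) (D : set T) (f : T -> R[i]) : R[i] :=
  (\int[mu]_(x in D) complex.Re (f x)) +i* (\int[mu]_(x in D) complex.Im (f x)).

(* z |-> e^(i theta) (a - z) / (1 - conj(a) z) *)
Definition mobius {R : realType} (theta : R) (a z : R[i]) : R[i] :=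
  (cos theta +i* sin theta) * ((a - z) / (1 - conjc a * z)).

(* The members of this group are maps of the disc to itself, so the values of g
   outside the disc are left unconstrained. *)
Definition Gplus {R : realType} : set (R[i] -> R[i]) :=
  [set g | exists theta a, [/\ 0 <= theta < 2 * pi, unit_disc a &
    forall z, unit_disc z -> g z = mobius theta a z]].

Definition admissible {R : realType} (D : set R[i]) : Prop :=
  [/\ D `<=` unit_disc, measurable (D : set (lebesgueC R)) &
      (0 < @hyperbolic_measure R D < +oo)%E].

(* The integrand is bounded by 1 on the disc, so it is integrable on D as soon as
   D is admissible, and Rintegral does not hit its default value. *)
Definition balanced {R : realType} (D : set R[i]) (c : R[i]) : Prop :=
  unit_disc c /\
  Cintegral (@hyperbolic_measure R) D
    (fun z : lebesgueC R => (c - (z : R[i])) / (1 - conjc c * z)) = 0.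

Definition conformal_barycenter {R : realType} (D : set R[i]) (c : R[i]) :
    Prop :=
  admissible D /\ unique (balanced D) c.

(* Main.v *)
From HB Require Import structures.
Require Import Defs.
From mathcomp Require Import all_boot all_order all_algebra.
From mathcomp Require Import complex ring lra.
From mathcomp Require Import all_classical all_reals all_analysis.
From mathcomp Require Import measurable_realfun.

(* A Möbius map g of the disc satisfies phi_(g c) (g z) = w * phi_c z, where
   phi_c z = (c - z) / (1 - conj(c) z) and w <> 0 does not depend on z.  So once
   the hyperbolic measure is known to be g-invariant, the integral of phi_(g c)
   over g(D) is w times the integral of phi_c over D, and g maps the balanced
   points of D bijectively onto those of g(D).

   For the invariance, g is an affine map, then z |-> 1/z, then an affine map.
   Up to conjugation the inversion is z |-> z/|z|^2, which preserves the slope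
   t = y/x and sends x to 1/(x(1 + t^2)).  All these maps are therefore composed
   of maps of the plane changing a single coordinate, for which the change of
   variables is Fubini-Tonelli together with the one-dimensional cases of
   x |-> ax + b and x |-> 1/x.  Borel sets sandwiching a Lebesgue-measurable set
   up to a null set carry the invariance over to all Lebesgue-measurable sets.
     *)

Set Implicit Arguments.
Unset Strict Implicit.
Unset Printing Implicit Defensive.

Import Order.TTheory GRing.Theory Num.Theory.
Import numFieldNormedType.Exports.
Import Normc.

Local Open Scope classical_set_scope.
Local Open Scope ring_scope.
Local Open Scope complex_scope.

Local Notation pushforward_measure :=
  measure_function_pushforward__canonical__measure_function_Measure.

(** * Change of variables on the line *)

Section with_density.
Context d (T : measurableType d) (R : realType).
Context (m : {measure set T -> \bar R}) (j : T -> R).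
Context (mj : measurable_fun setT j) (j0 : forall x, 0 <= j x).
Local Open Scope ereal_scope.

(** The two proofs are arguments so that the measure structure declared below can be inferred from
    the term alone. *)
Definition with_density of measurable_fun setT j & (forall x, (0 <= j x)%R) :
  set T -> \bar R := fun A => \int[m]_(x in A) (j x)%:E.

Local Notation mu := (with_density mj j0).

Let mu0 : mu set0 = 0.
Proof. by rewrite /with_density integral_set0. Qed.

Let mu_ge0 A : 0 <= mu A.
Proof. by apply: integral_ge0 => x _; rewrite lee_fin. Qed.

Let mu_sigma_additive : semi_sigma_additive mu.
Proof.
move=> /= F mF tF mUF; rewrite /with_density; apply: cvg_toP.
  apply: ereal_nondecreasing_is_cvgn => k n kn.
  by apply: lee_sum_nneg_natr => // i _ _; exact: mu_ge0.
rewrite ge0_integral_bigcup//=.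
- by apply: measurable_funTS; apply/measurable_EFinP.
- by move=> x _; rewrite lee_fin.
Qed.

HB.instance Definition _ := isMeasure.Build _ _ _ mu
  mu0 mu_ge0 mu_sigma_additive.

Import HBNNSimple.

(** Both sides pass to the limit along an increasing sequence of simple functions, by monotone
    convergence; on a simple function, linearity reduces the claim to indicators, where it is the
    definition of the density measure. *)
Lemma ge0_integral_with_density (f : T -> \bar R) :
  measurable_fun setT f -> (forall x, 0 <= f x) ->
  \int[mu]_x f x = \int[m]_x (f x * (j x)%:E).
Proof.
move=> mf f0; pose f_ := nnsfun_approx measurableT mf.
have mEj : measurable_fun setT (EFin \o j) by exact/measurable_EFinP.
have cvgf x : (EFin \o f_ ^~ x) @ \oo --> f x.
  by apply: cvg_nnsfun_approx.
transitivity (limn (fun n => \int[mu]_x (f_ n x)%:E)).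
  rewrite -monotone_convergence//=.
  - by apply: eq_integral => x _; apply/esym/cvg_lim => //; exact: cvgf.
  - by move=> n; exact/measurable_EFinP/measurable_funP.
  - by move=> n x _; rewrite lee_fin.
  - by move=> x _ k n kn; rewrite lee_fin; exact/lefP/nd_nnsfun_approx.
transitivity (limn (fun n => \int[m]_x ((f_ n x)%:E * (j x)%:E))); last first.
  rewrite -monotone_convergence//=.
  - apply: eq_integral => x _; apply/cvg_lim => //.
    by apply: cvgeZr => //; exact: cvgf.
  - by move=> n; apply: emeasurable_funM => //;
      exact/measurable_EFinP/measurable_funP.
  - by move=> n x _; rewrite mule_ge0// lee_fin.
  - move=> x _ k n kn; apply: lee_wpmul2r; rewrite ?lee_fin//.
    exact/lefP/nd_nnsfun_approx.
congr (limn _); apply/funext => n.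
rewrite integralT_nnsfun sintegralE.
under [RHS]eq_integral => x _.
  rewrite fimfunE -fsumEFin// ge0_mule_fsuml; last first.
    by move=> r; rewrite EFinM nnfun_muleindic_ge0.
  over.
rewrite /= ge0_integral_fsum//; last 2 first.
- move=> r; apply: emeasurable_funM => //.
  by apply/measurable_EFinP; exact/measurableT_comp.
- by move=> r x _; apply: mule_ge0;
    [exact: nnfun_muleindic_ge0|rewrite lee_fin].
apply: eq_fsbigr => r _.
(* A nonnegative simple function never takes a value r < 0, so such terms vanish on both sides. *)
have [r0|r0] := leP 0%R r; last first.
  rewrite preimage_nnfun0// measure0 mule0 [RHS](eq_integral (cst 0))
    ?integral0//.
  by move=> x _; rewrite indicE in_set0 mulr0 mul0e.
under [RHS]eq_integral do rewrite EFinM -muleA.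
rewrite ge0_integralZl//; last 2 first.
- by apply: emeasurable_funM => //; exact/measurable_EFinP.
- by move=> x _; rewrite mule_ge0// lee_fin.
congr (_ * _); rewrite /= /with_density integral_mkcond.
apply: eq_integral => x _; rewrite patchE indicE.
by case: ifPn => _; rewrite ?mul1e ?mul0e.
Qed.

End with_density.

(** The hypothesis on sets says that [phi] pushes the measure of density [j] forward to [m2], so a
    substitution rule only has to be checked on measurable sets. *)
Lemma ge0_change_of_variables d1 d2 (T1 : measurableType d1)
    (T2 : measurableType d2) (R : realType) (m1 : {measure set T1 -> \bar R})
    (m2 : {measure set T2 -> \bar R}) (phi : T1 -> T2) (j : T1 -> R) :
  measurable_fun setT phi -> measurable_fun setT j -> (forall x, 0 <= j x) ->
  (forall A, measurable A ->
    (\int[m1]_(x in phi @^-1` A) (j x)%:E = m2 A)%E) ->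
  forall f : T2 -> \bar R, measurable_fun setT f -> (forall y, (0 <= f y)%E) ->
  (\int[m1]_x (f (phi x) * (j x)%:E) = \int[m2]_y f y)%E.
Proof.
move=> mphi mj j0 H f mf f0.
rewrite -(@ge0_integral_with_density _ _ _ m1 _ mj j0 (f \o phi));
  [|exact: measurableT_comp|by move=> x; exact: f0].
rewrite -[LHS](@ge0_integral_pushforward _ _ _ _ _ phi mphi
  (with_density m1 mj j0) setT)//.
apply: (@eq_measure_integral _ _ _ setT m2
  (pushforward_measure
    (with_density m1 mj j0) mphi)).
by move=> A mA _; exact: H.
Qed.

Section one_dimension.
Context {R : realType}.
Local Notation mu := (@lebesgue_measure R).
Local Notation RR := (measurableTypeR R).

(** The power -1 agrees with the inverse on nonnegative reals, hence the detour through x *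
    (x^2)^(-1), which is also right at 0 since 0^-1 = 0. *)
Lemma measurable_inv : measurable_fun setT (@GRing.inv R).
Proof.
rewrite (_ : @GRing.inv R = fun x => x * (x ^+ 2) `^ (-1)).
  apply: measurable_funM => //; apply: (measurableT_comp (measurable_powR
    (-1))).
  exact: measurable_funX.
apply/funext => x; rewrite powR_inv1 ?sqr_ge0//.
have [->|x0] := eqVneq x 0; first by rewrite invr0 mul0r.
by rewrite expr2 invfM mulrA mulfV// mul1r.
Qed.

(** By uniqueness of Lebesgue measure it suffices to compare the pushforward with it on the
    intervals []l, r]]. *)
Lemma ge0_integral_affine (a b : R) (f : R -> \bar R) : a != 0 ->
  measurable_fun setT f -> (forall x, (0 <= f x)%E) ->
  (\int[mu]_x (f (a * x + b)%R * `|a|%:E) = \int[mu]_x f x)%E.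
Proof.
move=> a0 mf f0.
have mphi : measurable_fun setT (fun x : RR => a * x + b : RR).
  by apply: measurable_funD => //; exact: measurable_funM.
have mj : measurable_fun setT (cst `|a| : RR -> R) by exact: measurable_cst.
have j0 (x : R) : 0 <= cst `|a| x by exact: normr_ge0.
apply: (ge0_change_of_variables (j := cst `|a|)) => // A mA.
rewrite -/(with_density mu mj j0 _).
have mpre (B : set RR) : measurable B ->
    measurable ((fun x : RR => a * x + b : RR) @^-1` B).
  by move=> mB; rewrite -[X in measurable X]setTI; exact: mphi.
pose nu := pushforward_measure
  (with_density mu mj j0) mphi.
symmetry; apply: (@lebesgue_measure_unique R nu) => // _ [[l r] /= _ <-].
rewrite /nu/= /pushforward /with_density.
rewrite (eq_integral (cst `|a|%:E))// integral_cst//=; last exact: mpre.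
have [lr|rl] := ltP l r; last first.
  rewrite (@set_itv_ge _ _ (BRight l) (BRight r)).
    by rewrite preimage_set0 !measure0 mule0.
  by rewrite bnd_simp -leNgt.
have [agt0|alt0|aE] := ltgtP 0 a; last by rewrite -aE eqxx in a0.
- rewrite (_ : _ @^-1` _ = `](l - b) / a, (r - b) / a]%classic); last first.
    apply/seteqP; split => x /=; rewrite !in_itv/=.
      by rewrite ltr_pdivrMr// ler_pdivlMr// ltrBlDr lerBrDr mulrC.
    by rewrite ltr_pdivrMr// ler_pdivlMr// ltrBlDr lerBrDr mulrC.
  rewrite !lebesgue_measure_itv/= !lte_fin lr ifT; last first.
    by rewrite ltr_pM2r ?invr_gt0// ltrD2r.
  rewrite !EFinN -!EFinD -EFinM gtr0_norm//; congr EFin.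
  by field.
(* For a < 0 the ends are exchanged, so the preimage is closed on the left; its length is
   unaffected. *)
- rewrite (_ : _ @^-1` _ = `[(r - b) / a, (l - b) / a[%classic); last first.
    apply/seteqP; split => x /=; rewrite !in_itv/=.
      by rewrite ler_ndivrMr// ltr_ndivlMr// ltrBlDr lerBrDr mulrC andbC.
    by rewrite ler_ndivrMr// ltr_ndivlMr// ltrBlDr lerBrDr mulrC andbC.
  rewrite !lebesgue_measure_itv/= !lte_fin lr ifT; last first.
    by rewrite ltr_nM2r ?invr_lt0// ltrD2r.
  rewrite !EFinN -!EFinD -EFinM ltr0_norm//; congr EFin.
  by field.
Qed.

(** The antiderivative -1/x tends to 0 at infinity. The domain is the preimage of []0, c]] under
    inversion. *)
Lemma integral_inv_sqr (c : R) : 0 < c ->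
  (\int[mu]_(x in `[(c^-1)%R, +oo[) ((x^-1) ^+ 2)%:E = c%:E)%E.
Proof.
move=> c0.
have gt0 (x : R) : c^-1 <= x -> 0 < x.
  by apply: lt_le_trans; rewrite invr_gt0.
have dF (x : R) : 0 < x ->
    is_derive x 1 (fun x : R => - x^-1) ((x^-1) ^+ 2).
  move=> x0; have x0' : id x != 0 by rewrite gt_eqF.
  have := is_deriveN (is_deriveV x0' (is_derive_id x 1)).
  by move=> H; apply: is_derive_eq H _;
    rewrite scaleNr opprK [_ *: _]mulr1 exprVn.
have cV (x : R) : 0 < x -> {for x, continuous (@GRing.inv R)}.
  by move=> x0; apply: cvgV => //; rewrite gt_eqF.
have cf (x : R) : 0 < x -> {for x, continuous (fun x : R => (x^-1) ^+ 2)}.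
  by move=> x0; apply: cvgM; exact: cV.
have c10 : 0 < c^-1 by rewrite invr_gt0.
rewrite (@ge0_continuous_FTC2y _ _ (fun x => - x^-1) _ 0).
- by rewrite sub0e invrK -EFinN opprK.
- by move=> x _; exact: sqr_ge0.
- apply/continuous_within_itvcyP; split.
    by move=> x; rewrite in_itv/= andbT => /ltW/gt0; exact: cf.
  by apply: cvg_at_right_filter; exact: cf.
- rewrite -[X in _ --> X]oppr0; apply: cvgN.
  by apply/gtr0_cvgV0; [exact: nbhs_pinfty_gt|exact: cvg_id].
- by move=> x /ltW/gt0 /dF; case.
- apply: cvg_at_right_filter; apply: cvgN; exact: cV.
- move=> x; rewrite in_itv/= andbT => /ltW/gt0/dF[? <-].
  by rewrite derive1E.
Qed.
End one_dimension.

Section inversion.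
Context {R : realType}.
Local Notation mu := (@lebesgue_measure R).
Local Notation RR := (measurableTypeR R).

(** Uniqueness of Lebesgue measure again: the pushforward [nu] is computed on []0, c]], then on
    nonnegative intervals by difference, on nonpositive ones by reflection, and on the others by
    splitting at 0. *)
Lemma ge0_integral_inv (f : RR -> \bar R) :
  measurable_fun setT f -> (forall x, (0 <= f x)%E) ->
  (\int[mu]_x (f (x^-1)%R * (x^-1 ^+ 2)%:E) = \int[mu]_x f x)%E.
Proof.
move=> mf f0.
have mI : measurable_fun setT (fun x : RR => x^-1 : RR) by exact:
  measurable_inv.
have mj : measurable_fun setT (fun x : RR => x^-1 ^+ 2 : R).
  exact: measurable_funX.
have j0 (x : RR) : 0 <= x^-1 ^+ 2 :> R by exact: sqr_ge0.
have mpre (B : set RR) : measurable B ->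
    measurable ((fun x : RR => x^-1 : RR) @^-1` B).
  by move=> mB; rewrite -[X in measurable X]setTI; exact: mI.
apply: (ge0_change_of_variables (phi := fun x : RR => x^-1 : RR)
  (j := fun x : RR => x^-1 ^+ 2)) => // A mA.
rewrite -/(with_density mu mj j0 _).
pose nu := pushforward_measure
  (with_density mu mj j0) mI.
have nuE (B : set RR) :
  nu B = (\int[mu]_(x in (fun x : RR => (x^-1)%R : RR) @^-1` B) (x^-1 ^+
    2)%:E)%E.
  by [].
have mitv (i : interval R) : measurable ([set` i] : set RR).
  exact: measurable_itv.
(* Points being null, the ends of an interval may be added or removed; reflection will require
   this. *)
have nu1 (p : R) : nu [set p] = 0%E.
  rewrite nuE (_ : _ @^-1` _ = [set p^-1]); last first.
    by apply/seteqP; split => x /= => [<-|->]; rewrite invrK.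
  exact: integral_set1.
have nuU (a c b : R) : a <= c <= b ->
    nu `]a, b]%classic = (nu `]a, c]%classic + nu `]c, b]%classic)%E.
  move=> /andP[ac cb]; rewrite -measureU//.
    by congr (nu _); apply/seteqP; split => x /=; rewrite !in_itv/=; lra.
  by apply/seteqP; split => x //= []; rewrite !in_itv/=; lra.
have nu0 (c : R) : 0 <= c -> nu `]0, c]%classic = c%:E.
  rewrite le_eqVlt => /predU1P[<-|c0]; first by rewrite set_itvoc0 measure0.
  rewrite nuE -[RHS]integral_inv_sqr//; congr (integral _ _ _).
  apply/seteqP; split => x /=; rewrite !in_itv/= andbT.
    by move=> /andP[x0 xc]; rewrite -[x]invrK lef_pV2 ?posrE.
  move=> cx; have x0 : 0 < x by rewrite (lt_le_trans _ cx)// invr_gt0.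
  by rewrite invr_gt0 x0/= -[c]invrK lef_pV2 ?posrE ?invr_gt0.
have nu_pos (a b : R) : 0 <= a <= b -> nu `]a, b]%classic = (b - a)%:E.
  move=> /[dup] ab /andP[a0 ab']; have := nuU _ _ _ ab.
  rewrite !nu0//; last exact: le_trans ab'.
  move=> /eqP; rewrite addeC -sube_eq ?fin_num_adde_defl//.
  by move=> /eqP <-; rewrite EFinB.
(* Reflection commutes with inversion and preserves the density, but the closed end changes side. *)
have nuN (a b : R) : nu `]a, b]%classic = nu `[- b, - a[%classic.
  rewrite !nuE integral_mkcond [RHS]integral_mkcond/=.
  rewrite -[RHS](@ge0_integral_affine _ (-1) 0).
  - apply: eq_integral => x _; rewrite normrN1 mule1 addr0 mulN1r !patchE.
    have -> : (x \in (fun x : RR => x^-1) @^-1` `]a, b]) =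
       (- x \in (fun x : RR => x^-1) @^-1` `[- b, - a[).
      apply/idP/idP; rewrite !inE/= !in_itv/= invrN; lra.
    by rewrite invrN sqrrN.
  - by rewrite oppr_eq0 oner_eq0.
  - apply/(measurable_restrictT _ _).1; first exact: mpre.
    by apply: measurable_funTS; exact/measurable_EFinP.
  - by move=> x; rewrite patchE; case: ifP => // _; rewrite lee_fin.
have nu_neg (a b : R) : a <= b <= 0 -> nu `]a, b]%classic = (b - a)%:E.
  move=> /andP[ab b0]; rewrite nuN.
  have [->|ab'] := eqVneq a b; first by rewrite set_itvco0 measure0 subrr.
  have ltab : a < b by rewrite lt_neqAle ab'.
  (* The closed interval is the intermediate step between [[-b, -a[] and []-b, -a]]. *)
  transitivity (nu `[- b, - a]%classic).
    rewrite -(@setUitv1 _ _ (BLeft (- b)) (- a) true);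
      last by rewrite bnd_simp lerN2.
    rewrite measureU//; first by rewrite [X in (_ + X)%E](nu1 (- a)) adde0.
    by apply/seteqP; split => x //= -[];
      rewrite in_itv/= => /andP[_] /[swap] <-; rewrite ltxx.
  rewrite -(@setU1itv _ _ (BRight (- a)) (- b) false);
    last by rewrite bnd_simp lerN2.
  rewrite measureU//; last first.
    by apply/seteqP; split => x //= -[] <-; rewrite in_itv/= ltxx.
  rewrite [X in (X + _)%E](nu1 (- b)) add0e [LHS](nu_pos (- b) (- a));
    first by congr EFin; ring.
  by rewrite oppr_ge0 b0 lerN2.
symmetry; apply: (@lebesgue_measure_unique R nu) => // _ [[l r] /= _ <-].
have [lr|rl] := leP l r; last first.
  rewrite (@set_itv_ge _ _ (BRight l) (BRight r)) ?measure0//.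
  by rewrite bnd_simp -leNgt ltW.
transitivity (r - l)%:E.
  rewrite lebesgue_measure_itv/= lte_fin.
  by case: ltgtP lr => // -> _; rewrite subrr.
symmetry; have [l0|l0] := leP 0 l; first by rewrite nu_pos// l0.
have [r0|r0] := leP r 0; first by rewrite nu_neg// lr.
rewrite (nuU _ 0) ?(ltW l0) ?(ltW r0)// nu_neg ?lexx ?(ltW l0)// nu_pos ?lexx
  ?(ltW r0)//.
by rewrite -EFinD; congr EFin; ring.
Qed.
End inversion.

(** * Change of variables in the plane *)

Section jacobian.
Context {R : realType}.
Local Notation RR := (measurableTypeR R).
Local Notation mu := (@lebesgue_measure R).
Local Notation mu2 := (mu \x mu)%E.

(** An integrated form of the absolute Jacobian determinant: it involves no derivative, ignores null
    sets and is stable under composition. *)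
Definition has_jacobian (T : RR * RR -> RR * RR) (j : RR * RR -> R) : Prop :=
  [/\ measurable_fun setT T, measurable_fun setT j, forall p, 0 <= j p &
    forall f : RR * RR -> \bar R, measurable_fun setT f ->
      (forall p, (0 <= f p)%E) ->
      (\int[mu2]_p (f (T p) * (j p)%:E) = \int[mu2]_p f p)%E].

Lemma eq_has_jacobian T j T' j' : T =1 T' -> j =1 j' ->
  has_jacobian T j -> has_jacobian T' j'.
Proof. by move=> /funext -> /funext ->. Qed.

Lemma has_jacobian_comp T1 j1 T2 j2 : has_jacobian T1 j1 ->
  has_jacobian T2 j2 ->
  has_jacobian (T2 \o T1) (fun p => j2 (T1 p) * j1 p).
Proof.
move=> [mT1 mj1 j10 H1] [mT2 mj2 j20 H2]; split.
- exact: measurableT_comp.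
- by apply: measurable_funM => //; exact: measurableT_comp.
- by move=> p; exact: mulr_ge0.
- move=> f mf f0; rewrite -(H2 f)// -(H1 (fun p => f (T2 p) * (j2 p)%:E)%E).
  + by apply: eq_integral => p _ /=; rewrite EFinM muleA.
  + apply: emeasurable_funM; first exact: measurableT_comp.
    exact/measurable_EFinP.
  + by move=> p; rewrite mule_ge0// lee_fin.
Qed.

Lemma has_jacobian_swap : has_jacobian (fun p => (p.2, p.1)) (cst 1).
Proof.
have mswap : measurable_fun setT (fun p : RR * RR => (p.2, p.1)).
  by apply/measurable_fun_pair; [exact: measurable_snd|exact: measurable_fst].
split => // f mf f0.
under eq_integral do rewrite mule1.
rewrite fubini_tonelli1//; first by rewrite [RHS]fubini_tonelli2.
exact: measurableT_comp.
Qed.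

Lemma null_axis : mu2 ([set 0] `*` setT) = 0%E.
Proof.
by rewrite product_measure1E//= lebesgue_measure_set1 mul0e.
Qed.

(** The axis x = 0 is null, so formulas that divide by x only have to hold off it. *)
Lemma ae_eq_has_jacobian T j T' (j' : RR * RR -> R) :
  measurable_fun setT T' -> measurable_fun setT j' -> (forall p, 0 <= j' p) ->
  (forall p, p.1 != 0 :> R -> T p = T' p) ->
  (forall p, p.1 != 0 :> R -> j p = j' p) ->
  has_jacobian T j -> has_jacobian T' j'.
Proof.
move=> mT' mj' j'0 TT' jj' [mT mj j0 H]; split => // f mf f0.
rewrite -(H f)//; apply: ge0_ae_eq_integral => //.
- apply: emeasurable_funM; first exact: measurableT_comp.
  exact/measurable_EFinP.
- apply: emeasurable_funM; first exact: measurableT_comp.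
  exact/measurable_EFinP.
- by move=> p _; rewrite mule_ge0// lee_fin.
- by move=> p _; rewrite mule_ge0// lee_fin.
exists ([set 0] `*` setT); split; [exact: measurableX|exact: null_axis|].
move=> p /= /not_implyP[_ h]; split => //; apply: contra_notP h => /eqP p0.
by rewrite TT'// jj'.
Qed.

(** By Tonelli, the one-dimensional rule on each vertical fiber suffices. The fiber x = 0 is left
    out since maps such as y |-> x * y collapse it. *)
Lemma has_jacobian_fiber (phi : RR -> RR -> RR) (j : RR * RR -> R) :
  measurable_fun setT (fun p : RR * RR => phi p.1 p.2) ->
  measurable_fun setT j -> (forall p, 0 <= j p) ->
  (forall x, x != 0 :> R ->
    forall h : RR -> \bar R, measurable_fun setT h -> (forall y,
      (0 <= h y)%E) ->
    (\int[mu]_y (h (phi x y) * (j (x, y))%:E) = \int[mu]_y h y)%E) ->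
  has_jacobian (fun p => (p.1, phi p.1 p.2)) j.
Proof.
move=> mphi mj j0 H.
have mT : measurable_fun setT (fun p : RR * RR => (p.1, phi p.1 p.2)).
  by apply/measurable_fun_pair => //; exact: measurable_fst.
split => // f mf f0.
have mfj : measurable_fun setT (fun p : RR * RR => f (p.1,
  phi p.1 p.2) * (j p)%:E)%E.
  apply: emeasurable_funM; first exact: measurableT_comp.
  exact/measurable_EFinP.
have fj0 (p : RR * RR) : (0 <= f (p.1, phi p.1 p.2) * (j p)%:E)%E.
  by rewrite mule_ge0// lee_fin.
rewrite fubini_tonelli1// [RHS]fubini_tonelli1//.
apply: ge0_ae_eq_integral => //.
- exact: (measurable_fun_fubini_tonelli_F (m2 := mu)).
- exact: (measurable_fun_fubini_tonelli_F (m2 := mu)).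
- by move=> x _; exact: integral_ge0.
- by move=> x _; exact: integral_ge0.
exists [set 0]; split => //; first exact: lebesgue_measure_set1.
move=> x /= /not_implyP[_ h]; apply: contra_notP h => /eqP x0.
rewrite /fubini_F/= (H x x0 (fun y => f (x, y)))//.
exact: measurableT_comp.
Qed.

End jacobian.

(** * Affine maps, conjugation and inversion of the complex plane *)

Section plane_maps.
Context {R : realType}.
Local Notation RR := (measurableTypeR R).
Local Notation mu := (@lebesgue_measure R).

(** Conjugation by the swap of coordinates, whose Jacobian is 1. *)
Lemma has_jacobian_fiber_fst (phi : RR -> RR -> RR) (j : RR * RR -> R) :
  has_jacobian (fun p => (p.1, phi p.1 p.2)) j ->
  has_jacobian (fun p => (phi p.2 p.1, p.2)) (fun p => j (p.2, p.1)).
Proof.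
move=> H.
have := has_jacobian_comp (has_jacobian_comp has_jacobian_swap H)
  has_jacobian_swap.
by apply: eq_has_jacobian => p //=; rewrite mul1r mulr1.
Qed.

Lemma has_jacobian_affine_snd (u : R) (c : RR -> RR) : u != 0 ->
  measurable_fun setT c ->
  has_jacobian (fun p => (p.1, u * p.2 + c p.1)) (cst `|u|).
Proof.
move=> u0 mc; apply: (@has_jacobian_fiber _ (fun x y => u * y + c x)).
- apply: (@measurable_funD _ _ _ _ (fun p : RR * RR => u * p.2) (c \o fst)).
    by apply: measurable_funM => //; exact: measurable_snd.
  by apply: measurableT_comp => //; exact: measurable_fst.
- exact: measurable_cst.
- by move=> p; exact: normr_ge0.
- by move=> x _ h mh h0; exact: ge0_integral_affine.
Qed.

Lemma has_jacobian_affine_fst (u : R) (c : RR -> RR) : u != 0 ->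
  measurable_fun setT c ->
  has_jacobian (fun p => (u * p.1 + c p.2, p.2)) (cst `|u|).
Proof.
move=> u0 mc.
apply: (@has_jacobian_fiber_fst (fun y x => u * x + c y) (cst `|u|)).
exact: has_jacobian_affine_snd.
Qed.

Definition complex_to_pair (z : R[i]) : RR * RR := (complex.Re z, complex.Im z).
(* [complex_of_pair] with the Borel sets of the plane as measurable sets *)
Definition pair_to_complex (p : RR * RR) : R[i] := p.1 +i* p.2.

Lemma normc_sqr (z : R[i]) :
  normc z ^+ 2 = complex.Re z ^+ 2 + complex.Im z ^+ 2.
Proof. by case: z => x y; rewrite /normc sqr_sqrtr// addr_ge0 ?sqr_ge0. Qed.

Definition has_complex_jacobian (F : R[i] -> R[i]) (j : R[i] -> R) :=
  has_jacobian (complex_to_pair \o F \o pair_to_complex) (j \o pair_to_complex).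

Lemma complex_to_pairK : cancel complex_to_pair pair_to_complex.
Proof. by case. Qed.

Lemma has_complex_jacobian_comp F1 j1 F2 j2 :
  has_complex_jacobian F1 j1 -> has_complex_jacobian F2 j2 ->
  has_complex_jacobian (F2 \o F1) (fun z => j2 (F1 z) * j1 z).
Proof.
move=> H1 H2; have := has_jacobian_comp H1 H2.
by apply: eq_has_jacobian => p /=; rewrite complex_to_pairK.
Qed.

(** Multiplication by w = u + iv has matrix ((u, -v), (v, u)), which is factored into maps changing
    one coordinate at a time. *)
Lemma has_complex_jacobian_affine (w b : R[i]) : w != 0 ->
  has_complex_jacobian (fun z => w * z + b) (fun=> normc w ^+ 2).
Proof.
case: w b => u v [s t]; rewrite eq_complex/= negb_and => w0.
have mlin (a c e : R) : measurable_fun setT (fun x : RR => a * (x - c) + e :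
  RR).
  apply: measurable_funD => //; apply: measurable_funM => //.
  exact: measurable_funB.
(* For u = 0 the triangular factorization would divide by 0, but the matrix is a swap followed by
   scalings. *)
have [u0|u0] := eqVneq u 0.
  have v0 : v != 0 by move: w0; rewrite u0 eqxx.
  have Nv0 : - v != 0 by rewrite oppr_eq0.
  have H1 := has_jacobian_affine_fst Nv0 (mlin 0 0 s).
  have H2 := has_jacobian_affine_snd v0 (mlin 0 0 t).
  have := has_jacobian_comp (has_jacobian_comp has_jacobian_swap H1) H2.
  apply: eq_has_jacobian => -[x y]; rewrite /complex_to_pair /=.
    by rewrite u0; congr pair; ring.
  by rewrite sqr_sqrtr ?addr_ge0 ?sqr_ge0// u0 normrN mulr1 -normrM ger0_norm
    -?expr2 ?sqr_ge0//; ring.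
have w2 : 0 < u ^+ 2 + v ^+ 2 by rewrite ltr_wpDr ?sqr_ge0// exprn_even_gt0.
have w2u0 : (u ^+ 2 + v ^+ 2) / u != 0 by rewrite mulf_neq0 ?invr_eq0// gt_eqF.
(* First y' = u y + v x + t, then x' = (|w|^2 / u) x - (v / u) (y' - t) + s, which simplifies to u x
   - v y + s. *)
have H1 := has_jacobian_affine_snd u0 (mlin v 0 t).
have H2 := has_jacobian_affine_fst w2u0 (mlin (- v / u) t s).
have := has_jacobian_comp H1 H2.
apply: eq_has_jacobian => -[x y]; rewrite /complex_to_pair /=.
  by congr pair; [field|ring].
by rewrite sqr_sqrtr ?(ltW w2)// -normrM ger0_norm divfK// ltW.
Qed.

(** With t = y/x, the map factors as (x, y) |-> (x, t), then (x, t) |-> (1 / ((1 + t^2) x), t), then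
    (x', t) |-> (x', x' t), which are [H1], [H2] and [H3]. *)
Lemma has_jacobian_inv_conj : has_jacobian
  (fun p : RR * RR => (p.1 / (p.1 ^+ 2 + p.2 ^+ 2),
    p.2 / (p.1 ^+ 2 + p.2 ^+ 2)))
  (fun p => (p.1 ^+ 2 + p.2 ^+ 2)^-1 ^+ 2).
Proof.
have m1 : measurable_fun setT (fun p : RR * RR => p.1 : R).
  exact: measurable_fst.
have m2 : measurable_fun setT (fun p : RR * RR => p.2 : R).
  exact: measurable_snd.
have mV (f : RR * RR -> R) : measurable_fun setT f ->
    measurable_fun setT (fun p => (f p)^-1).
  by move=> mf; apply: measurableT_comp mf; exact: measurable_inv.
have mN (f : RR * RR -> R) : measurable_fun setT f ->
    measurable_fun setT (fun p => `|f p|).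
  by move=> mf; apply: measurableT_comp mf; exact: normr_measurable.
have mn : measurable_fun setT (fun p : RR * RR => p.1 ^+ 2 + p.2 ^+ 2 : R).
  by apply: measurable_funD; exact: measurable_funX.
have q0 (t : R) : 0 < 1 + t ^+ 2 by rewrite ltr_wpDr ?sqr_ge0.
have H1 : has_jacobian (fun p : RR * RR => (p.1, p.1^-1 * p.2 : RR))
    (fun p => `|p.1^-1|).
  apply: (@has_jacobian_fiber _ (fun x y : RR => x^-1 * y : RR)).
  - by apply: measurable_funM => //; exact: mV.
  - by apply: (mN (fun p => p.1^-1)); exact: mV.
  - by move=> p; exact: normr_ge0.
  - move=> x x0 h mh h0; rewrite -[RHS](@ge0_integral_affine _ x^-1 0)//.
      by under [RHS]eq_integral do rewrite addr0.
    by rewrite invr_eq0.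
have H2 : has_jacobian (fun p : RR * RR => (((1 + p.2 ^+ 2) * p.1)^-1 : RR,
  p.2))
    (fun p => ((1 + p.2 ^+ 2) * p.1)^-1 ^+ 2 * (1 + p.2 ^+ 2)).
  have mt : measurable_fun setT (fun p : RR * RR => 1 + p.1 ^+ 2 : R).
    by apply: measurable_funD => //; apply: measurable_funX.
  have mV2 : measurable_fun setT (fun p : RR * RR => ((1 + p.1 ^+ 2) * p.2)^-1
    : R).
    by apply: mV; exact: measurable_funM.
  apply: (@has_jacobian_fiber_fst (fun t x => ((1 + t ^+ 2) * x)^-1)
    (fun p => ((1 + p.1 ^+ 2) * p.2)^-1 ^+ 2 * (1 + p.1 ^+ 2))).
  apply: (@has_jacobian_fiber _ (fun t x => ((1 + t ^+ 2) * x)^-1)) => //.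
  - by apply: measurable_funM => //; exact: measurable_funX.
  - by move=> p; rewrite mulr_ge0 ?sqr_ge0// ltW.
  (* For fixed t this is scaling by 1 + t^2 followed by inversion. *)
  - move=> t _ h mh h0; rewrite -[RHS]ge0_integral_inv//.
    rewrite -[RHS](@ge0_integral_affine _ (1 + t ^+ 2) 0); first last.
    + by move=> x; rewrite mule_ge0// lee_fin sqr_ge0.
    + apply: emeasurable_funM.
        by apply: (measurableT_comp mh); exact: measurable_inv.
      by apply/measurable_EFinP; apply: measurable_funX; exact: measurable_inv.
    + by rewrite gt_eqF.
    apply: eq_integral => x _; rewrite addr0 /= EFinM muleA gtr0_norm//.
have H3 : has_jacobian (fun p : RR * RR => (p.1, p.1 * p.2 : RR))
    (fun p => `|p.1|).
  apply: (@has_jacobian_fiber _ (fun x y : RR => x * y : RR)).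
  - exact: measurable_funM.
  - exact: (mN fst).
  - by move=> p; exact: normr_ge0.
  - move=> x x0 h mh h0; rewrite -[RHS](@ge0_integral_affine _ x 0)//.
    by under [RHS]eq_integral do rewrite addr0.
(* The slope only makes sense for x != 0, so the composite is the desired map off the axis. *)
apply: (ae_eq_has_jacobian _ _ _ _ _
  (has_jacobian_comp (has_jacobian_comp H1 H2) H3)).
- by apply/measurable_fun_pair; apply: measurable_funM => //; exact: mV.
- by apply: measurable_funX; exact: mV.
- by move=> p; exact: sqr_ge0.
- move=> [x y]/= x0; have w0 : x ^+ 2 + y ^+ 2 != 0.
    by rewrite gt_eqF// ltr_wpDr ?sqr_ge0// exprn_even_gt0.
  have h : (1 + (x^-1 * y) ^+ 2) * x = (x ^+ 2 + y ^+ 2) / x by field.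
  by rewrite h; congr pair; field; rewrite w0 x0.
- move=> [x y]/= x0; have w0 : 0 < x ^+ 2 + y ^+ 2.
    by rewrite ltr_wpDr ?sqr_ge0// exprn_even_gt0.
  have h : (1 + (x^-1 * y) ^+ 2) = (x ^+ 2 + y ^+ 2) / x ^+ 2 by field.
  rewrite [_ * `|x^-1|]mulrC mulrCA -mulrA mulrA -normrM h.
  have -> : x^-1 * ((x ^+ 2 + y ^+ 2) / x ^+ 2 * x)^-1 = (x ^+ 2 + y ^+ 2)^-1.
    by field; rewrite x0 gt_eqF.
  rewrite gtr0_norm ?invr_gt0//.
  by field; rewrite x0 gt_eqF.
Qed.

Lemma has_complex_jacobian_conj : has_complex_jacobian (@conjc R) (fun=> 1).
Proof.
have N10 : (-1 : R) != 0 by rewrite oppr_eq0 oner_eq0.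
have := has_jacobian_affine_snd N10 (measurable_cst (0 : RR)).
by apply: eq_has_jacobian => -[x y];
  rewrite ?normrN1// /complex_to_pair /= mulN1r addr0.
Qed.

(** 1/z is the conjugate of z/|z|^2. *)
Lemma has_complex_jacobian_inv :
  has_complex_jacobian (@GRing.inv R[i]) (fun z => normc z ^- 4).
Proof.
have := has_jacobian_comp has_jacobian_inv_conj has_complex_jacobian_conj.
apply: eq_has_jacobian => -[x y]; first by [].
by rewrite mul1r [RHS]/comp (exprM _ 2 2) normc_sqr /= exprVn.
Qed.

End plane_maps.

(** * Möbius maps of the disc *)

Section mobius_algebra.
Context {R : realType}.
Implicit Types (a z w : R[i]) (theta : R).

Definition cis theta : R[i] := cos theta +i* sin theta.

Lemma normc_cis theta : normc (cis theta) = 1.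
Proof. by rewrite /= cos2Dsin2 sqrtr1. Qed.

Lemma cis_neq0 theta : cis theta != 0.
Proof.
apply/eqP => e0; have := normc_cis theta.
by rewrite e0 normc0 => /esym/eqP; rewrite oner_eq0.
Qed.

Lemma conjc_cis theta : conjc (cis theta) = (cis theta)^-1.
Proof.
apply: (mulfI (cis_neq0 theta)); rewrite mulfV ?cis_neq0//; apply/eqP;
  rewrite eq_complex /=.
by apply/andP; split; apply/eqP; have := cos2Dsin2 theta; lra.
Qed.

Lemma conjcM z w : conjc (z * w) = conjc z * conjc w.
Proof. exact: rmorphM. Qed.

Lemma conjcB z w : conjc (z - w) = conjc z - conjc w.
Proof. exact: rmorphB. Qed.

Lemma cisN theta : cis (- theta) = (cis theta)^-1.
Proof. by rewrite -conjc_cis /cis cosN sinN. Qed.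

Lemma unit_discP z : unit_disc z <-> 0 < 1 - normc z ^+ 2.
Proof. by rewrite /unit_disc/= subr_gt0 expr_lt1// normc_ge0. Qed.

Lemma normc_conj z : normc (conjc z) = normc z.
Proof. by case: z => x y; rewrite /= sqrrN. Qed.

Lemma normc_neq0 z : (normc z != 0) = (z != 0).
Proof.
apply/idP/idP; apply: contra => /eqP; last by move/eq0_normc->.
by move->; rewrite normc0.
Qed.

Lemma normc_opp z : normc (- z) = normc z.
Proof. by case: z => x y; rewrite /= !sqrrN. Qed.

Lemma denom_neq0 a z : unit_disc a -> unit_disc z -> 1 - conjc a * z != 0.
Proof.
move=> a1 z1; rewrite subr_eq0; apply/eqP => h.
have : normc a * normc z < 1 by rewrite mulr_ilt1// normc_ge0.
by rewrite -(normc_conj a) -normcM -h normc1 ltxx.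
Qed.

(** Divided by |1 - conj(a) z|^2, this identity computes 1 - |g z|^2, hence the density at g z. *)
Lemma normc_denomB a z :
  normc (1 - conjc a * z) ^+ 2 - normc (a - z) ^+ 2 =
  (1 - normc a ^+ 2) * (1 - normc z ^+ 2).
Proof. by rewrite !normc_sqr; case: a z => u v [x y] /=; ring. Qed.

Lemma mobius_norm theta a z : 1 - conjc a * z != 0 ->
  1 - normc (mobius theta a z) ^+ 2 =
  (1 - normc a ^+ 2) * (1 - normc z ^+ 2) / normc (1 - conjc a * z) ^+ 2.
Proof.
move=> h; rewrite /mobius -/(cis theta) 2!normcM normc_cis mul1r normcV.
by rewrite -normc_denomB; field; rewrite normc_neq0.
Qed.

Lemma mobius_disc theta a z :
  unit_disc a -> unit_disc z -> unit_disc (mobius theta a z).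
Proof.
move=> a1 z1; have h := denom_neq0 a1 z1.
apply/unit_discP; rewrite mobius_norm// divr_gt0//.
  by apply: mulr_gt0; apply/unit_discP.
by rewrite exprn_gt0// lt_neqAle normc_ge0 eq_sym normc_neq0 h.
Qed.

(** The map sends 0 to [cis theta * a], so the inverse must vanish there, which dictates its
    parameters. *)
Lemma mobiusK theta a z : unit_disc a -> unit_disc z ->
  mobius (- theta) (cis theta * a) (mobius theta a z) = z.
Proof.
move=> a1 z1; have h := denom_neq0 a1 z1; have h' := denom_neq0 a1 a1.
have e0 := cis_neq0 theta.
rewrite /mobius -/(cis (- theta)) -/(cis theta) cisN.
rewrite conjcM conjc_cis.
(* With the conjugate abstracted, the claim is a rational identity in independent variables, within
   reach of [field]. *)
move: h h'; set b := conjc a; set e := cis theta => h h'.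
field; rewrite e0 h /=.
suff -> : 1 - b * z - b * (a - z) = 1 - b * a by [].
by ring.
Qed.

Lemma unit_disc_cisM theta a : unit_disc a -> unit_disc (cis theta * a).
Proof. by rewrite /unit_disc/= normcM normc_cis mul1r. Qed.

(** The integrand of [balanced], to which it is convertible. *)
Definition blaschke (c z : R[i]) : R[i] := (c - z) / (1 - conjc c * z).

Lemma blaschkeE (c z : R[i]) : blaschke c z = mobius 0 c z.
Proof. by rewrite /mobius cos0 sin0 mul1r. Qed.

(** As functions of z, both [blaschke] terms are disc automorphisms vanishing at c, so they differ
    by a constant factor, given here explicitly. *)
Lemma blaschke_mobius theta a c z :
  unit_disc a -> unit_disc c -> unit_disc z ->
  blaschke (mobius theta a c) (mobius theta a z) =
  - cis theta * ((1 - a * conjc c) / (1 - conjc a * c)) * blaschke c z.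
Proof.
move=> a1 c1 z1; rewrite /blaschke.
have haz := denom_neq0 a1 z1; have hac := denom_neq0 a1 c1.
have haa := denom_neq0 a1 a1; have hcz := denom_neq0 c1 z1.
have hca := denom_neq0 c1 a1.
have e0 := cis_neq0 theta.
rewrite /mobius -/(cis theta).
rewrite !(conjcM, conjc_inv, conjcB, conjc1, conjcK, conjc_cis).
move: haz hac haa hcz hca; set b := conjc a; set d := conjc c;
  set e := cis theta.
move=> haz hac haa hcz hca.
have had : 1 - a * d != 0 by rewrite mulrC.
field.
rewrite haz hac hcz had e0 /=.
(* The left side is the numerator of 1 - conj(g c) * g z; factored, it is visibly nonzero. *)
suff -> : (1 - a * d) * (1 - b * z) - (b - d) * (a - z) = (1 - b * a) * (1 - d
  * z).
  by rewrite mulf_neq0.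
by ring.
Qed.

(** The second factor is |g'(z)|^2, the Jacobian of the Möbius map g. *)
Lemma mobius_density theta a z : unit_disc a -> unit_disc z ->
  hyperbolic_density (mobius theta a z) *
    ((1 - normc a ^+ 2) ^+ 2 / normc (1 - conjc a * z) ^+ 4) =
  hyperbolic_density z.
Proof.
move=> a1 z1; have h := denom_neq0 a1 z1.
rewrite /hyperbolic_density mobius_norm//.
have := normc_neq0 (1 - conjc a * z); rewrite h => q0.
move/unit_discP : a1 => /gt_eqF/negbT a0;
  move/unit_discP : z1 => /gt_eqF/negbT z0.
by field; rewrite a0 z0 q0.
Qed.

(** F replaces [mobius], which by x / 0 = 0 sends its pole into the disc. The last clause keeps
    points outside the disc from entering it, so preimages under F of subsets of the disc stay in
    the disc. *)
Lemma mobius_has_complex_jacobian theta a : unit_disc a ->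
  exists F j, [/\ has_complex_jacobian F j,
    forall z, unit_disc z -> F z = mobius theta a z,
    forall z, unit_disc z ->
      j z = (1 - normc a ^+ 2) ^+ 2 / normc (1 - conjc a * z) ^+ 4 &
    forall z, unit_disc (F z) -> unit_disc z].
Proof.
move=> a1; have e0 := cis_neq0 theta; have [aE|a0] := eqVneq a 0.
  have Ne0 : - cis theta != 0 by rewrite oppr_eq0.
  eexists _, _; split; first exact: (has_complex_jacobian_affine 0 Ne0).
  - move=> z _; rewrite aE /mobius -/(cis theta) rmorph0 mul0r subr0 divr1.
    by rewrite sub0r mulrN mulNr addr0.
  - move=> z _; rewrite normc_opp normc_cis aE rmorph0 mul0r subr0 normc0
      normc1.
    by rewrite expr0n subr0 !expr1n divr1.
  - by move=> z /=; rewrite addr0 /unit_disc /mkset normcM normc_opp normc_cis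
      mul1r.
have b0 : conjc a != 0 by rewrite -normc_neq0 normc_conj normc_neq0.
have h' := denom_neq0 a1 a1.
(* Partial fractions: with e = [cis theta] and b = conj(a), e (a - z) / (1 - b z) = e / b + beta /
   (1 - b z). *)
pose beta := - cis theta / conjc a * (1 - conjc a * a).
have beta0 : beta != 0 by rewrite !mulf_neq0// ?invr_eq0// oppr_eq0.
have Nb0 : - conjc a != 0 by rewrite oppr_eq0.
exists (fun z => beta * (- conjc a * z + 1)^-1 + cis theta / conjc a).
have FE z : 1 - conjc a * z != 0 ->
    beta * (- conjc a * z + 1)^-1 + cis theta / conjc a = mobius theta a z.
  move=> h; rewrite /mobius -/(cis theta) /beta.
  move: b0 h; set b := conjc a => b0 h.
  by field; rewrite h b0.
have H := has_complex_jacobian_comp (has_complex_jacobian_comp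
  (has_complex_jacobian_affine 1 Nb0)
  has_complex_jacobian_inv) (has_complex_jacobian_affine (cis theta / conjc a)
    beta0).
eexists; split; first exact: H.
- by move=> z z1; apply: FE; exact: denom_neq0.
- move=> z z1; have h := denom_neq0 a1 z1.
  have nb : normc (1 - conjc a * a) = 1 - normc a ^+ 2.
    have -> : 1 - conjc a * a = (1 - normc a ^+ 2)%:C.
      rewrite normc_sqr; case: (a) => x y; apply/eqP.
      by rewrite eq_complex /=; apply/andP; split; apply/eqP; ring.
    by rewrite /normc/= expr0n/= addr0 sqrtr_sqr gtr0_norm//; apply/unit_discP.
  rewrite /beta !normcM nb !(normcV, normc_opp) normc_cis normc_conj.
  rewrite mulNr [- (_ * _) + 1]addrC.
  field; rewrite !normc_neq0 a0 h //.
(* At the pole F takes the value e / conj(a), of modulus 1/|a| > 1. Elsewhere 1 - |F z|^2 has the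
   sign of 1 - |z|^2. *)
- move=> z /=; have [h|h] := eqVneq (1 - conjc a * z) 0.
    have -> : - conjc a * z + 1 = 0 by rewrite mulNr addrC.
    rewrite invr0 mulr0 add0r /unit_disc /mkset normcM normcV.
    rewrite normc_cis normc_conj mul1r => /ltW; rewrite leNgt.
    have na0 : 0 < normc a by rewrite lt_neqAle normc_ge0 eq_sym normc_neq0 a0.
    by rewrite invf_gt1// (a1 : normc a < 1).
  rewrite FE// => /unit_discP; rewrite mobius_norm// => H0.
  apply/unit_discP; move: H0.
  rewrite pmulr_lgt0; last first.
    by rewrite invr_gt0 exprn_gt0// lt_neqAle normc_ge0 eq_sym normc_neq0 h.
  by rewrite pmulr_rgt0//; apply/unit_discP.
Qed.

End mobius_algebra.

(** * Invariance of the hyperbolic measure *)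

Section caratheodory_approximation.
Local Open Scope ereal_scope.
Context d (T : measurableType d) (R : realType) (m : {measure set T -> \bar R}).
Local Notation "'m^*'" := (mu_ext m) (at level 0).

(** The outer measure is an infimum over countable covers; the hull intersects the unions of covers
    that are optimal up to 1/(n + 1). *)
Lemma mu_ext_hull (X : set T) : m^* X < +oo ->
  exists H, [/\ measurable H, X `<=` H & m H = m^* X].
Proof.
move=> Xoo.
have Xfin : m^* X \is a fin_num.
  by rewrite ge0_fin_numE//; exact: (outer_measure_ge0 m^*).
have coverX n : exists F : (set T)^nat,
    measurable_cover X F /\ \sum_(k <oo) m (F k) < m^* X + n.+1%:R^-1%:E.
  have n0 : (0 < n.+1%:R^-1 :> R)%R by rewrite invr_gt0.
  have [_ [F XF <-] ltF] := lb_ereal_inf_adherent n0 Xfin.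
  by exists F.
have [F FP] := choice coverX.
have mF n k : measurable (F n k) by have [[/(_ k)]] := FP n.
have mU n : measurable (\bigcup_k F n k) by exact: bigcupT_measurable.
exists (\bigcap_n \bigcup_k F n k).
have mH : measurable (\bigcap_n \bigcup_k F n k) by exact: bigcapT_measurable.
have XH : X `<=` \bigcap_n \bigcup_k F n k.
  by apply: sub_bigcap => n _; have [[_]] := FP n.
split => //; apply/eqP; rewrite eq_le; apply/andP; split; last first.
  by rewrite -(measurable_mu_extE m mH); exact: (le_outer_measure m^*).
apply/lee_addgt0Pr => _/posnumP[e]; near \oo => n.
have -> : m (\bigcap_n \bigcup_k F n k) =
    m^* (\bigcap_n \bigcup_k F n k) by rewrite measurable_mu_extE.
apply: (@le_trans _ _ (m^* (\bigcup_k F n k))).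
  by apply: (le_outer_measure m^*); exact: bigcap_inf.
rewrite measurable_mu_extE//.
apply: (@le_trans _ _ (\sum_(k <oo) m (F n k))).
  exact: measure_sigma_subadditive.
have [_ /ltW/le_trans] := FP n; apply.
rewrite leeD2l// lee_fin ltW//.
by near: n; exact: near_infty_natSinv_lt.
Unshelve. all: by end_near. Qed.

(** Take for C a hull of A, and for B what is left of C after removing a null hull of C minus A. *)
Lemma caratheodory_sandwich (A : set T) :
  m^*.-cara.-measurable A -> m^* A < +oo ->
  exists B C, [/\ measurable B, measurable C, B `<=` A, A `<=` C &
    m (C `\` B) = 0].
Proof.
move=> mA Aoo.
have Afin : m^* A \is a fin_num.
  by rewrite ge0_fin_numE//; exact: (outer_measure_ge0 m^*).
have [H [mH AH mHA]] := mu_ext_hull Aoo.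
(* The Carathéodory criterion splits H along A, and the finite value m^* A = m H cancels. *)
have HA0 : m^* (H `\` A) = 0.
  have mHE : m^* H = m H by exact: measurable_mu_extE.
  have : m^* H = m^* (H `&` A) + m^* (H `&` ~` A) by exact: mA.
  rewrite mHE mHA (setIidr AH) -setDE => /eqP.
  by rewrite addeC -sube_eq ?fin_num_adde_defl// subee// => /eqP <-.
have [|N [mN HAN mN0]] := @mu_ext_hull (H `\` A); first by rewrite HA0.
exists (H `\` N), H; split => //; first exact: measurableD.
  by move=> x [Hx Nx]; apply: contrapT => Ax; apply: Nx; exact: HAN.
apply: (@subset_measure0 _ _ _ m _ N) => //.
- by apply: measurableD => //; exact: measurableD.
- by move=> x [Hx] /not_andP[//|/contrapT].
- exact: (etrans mN0 HA0).
Qed.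

End caratheodory_approximation.

(** * Invariance on Borel sets, then on all Lebesgue-measurable sets *)

Section invariance.
Context {R : realType}.
Local Notation RR := (measurableTypeR R).
Local Notation mu := (@lebesgue_measure R).
Local Notation mu2 := (mu \x mu)%E.
Local Notation hyp := (@hyperbolic_measure R).

Lemma measurable_normc_pair :
  measurable_fun setT (fun p : RR * RR => normc (pair_to_complex p) ^+ 2 : R).
Proof.
rewrite (_ : (fun _ => _) = fun p : RR * RR => p.1 ^+ 2 + p.2 ^+ 2 : R);
  last first.
  by apply/funext => p; rewrite normc_sqr.
apply: measurable_funD; apply: measurable_funX;
  [exact: measurable_fst|exact: measurable_snd].
Qed.

(* The suffix [pair] marks the Borel counterparts, on R * R, of notions on
   [lebesgueC R] *)
Definition disc_pair : set (RR * RR) := pair_to_complex @^-1` unit_disc.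

Lemma measurable_disc_pair : measurable disc_pair.
Proof.
rewrite (_ : disc_pair =
    (fun p : RR * RR => normc (pair_to_complex p) ^+ 2 : R) @^-1` `]-oo, 1[).
  by rewrite -[X in measurable X]setTI; exact: measurable_normc_pair.
apply/seteqP; split => p; rewrite /disc_pair /unit_disc /preimage /mkset
  in_itv/=;
  by rewrite expr_lt1// normc_ge0.
Qed.

Lemma measurable_density_pair :
  measurable_fun setT (fun p : RR * RR => hyperbolic_density (pair_to_complex
    p) : R).
Proof.
rewrite /hyperbolic_density.
apply: (measurableT_comp (@measurable_inv R)).
apply: measurable_funX; apply: measurable_funB => //.
exact: measurable_normc_pair.
Qed.

Definition hyperbolic_pair (B : set (RR * RR)) : \bar R :=
  (\int[mu2]_(p in B `&` disc_pair)
     (hyperbolic_density (pair_to_complex p))%:E)%E.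

Lemma measurable_complex_to_pair :
  measurable_fun setT (complex_to_pair : lebesgueC R -> RR * RR).
Proof.
by apply/measurable_fun_pair; [exact: measurable_ReC|exact: measurable_ImC].
Qed.

Lemma measurable_preimage_pair (B : set (RR * RR)) : measurable B ->
  measurable (complex_to_pair @^-1` B : set (lebesgueC R)).
Proof.
by move=> mB; rewrite -[X in measurable X]setTI;
  exact: measurable_complex_to_pair.
Qed.

Lemma lebesgue_measureC_pair (B : set (RR * RR)) : measurable B ->
  lebesgue_measureC (complex_to_pair @^-1` B : set (lebesgueC R)) = mu2 B.
Proof.
move=> mB; rewrite -[RHS](measurable_mu_extE _ mB).
by rewrite /lebesgue_measureC /pushforward /lebesgue_measure2
  /completed_measure_extension; congr (mu_ext _ _); apply/seteqP; split => -[].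
Qed.

(** On Borel sets the completed measure is the product measure, so the computation moves to the
    plane, where the Jacobians live. *)
Lemma hyperbolic_measure_pair (B : set (RR * RR)) : measurable B ->
  hyp (complex_to_pair @^-1` B) = hyperbolic_pair B.
Proof.
move=> mB; rewrite /hyperbolic_measure /hyperbolic_pair.
have mBd : measurable (B `&` disc_pair).
  by apply: measurableI => //; exact: measurable_disc_pair.
have mh := measurable_density_pair.
transitivity (\int[pushforward lebesgue_measureC
    (complex_to_pair : lebesgueC R -> RR * RR)]_(p in B `&` disc_pair)
    (hyperbolic_density (pair_to_complex p))%:E)%E; last first.
  apply: (@eq_measure_integral _ _ _ _ mu2
    (pushforward_measure
      (@lebesgue_measureC R) measurable_complex_to_pair)).
  by move=> X mX _; exact: lebesgue_measureC_pair.
rewrite (ge0_integral_pushforward measurable_complex_to_pair)//.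
- rewrite (_ : complex_to_pair @^-1` (B `&` disc_pair) =
    complex_to_pair @^-1` B `&` unit_disc).
    by apply: eq_integral => z _ /=; rewrite complex_to_pairK.
  by rewrite preimage_setI; congr (_ `&` _); apply/seteqP; split => -[].
- by apply: measurable_funTS; exact/measurable_EFinP.
- by move=> p _; rewrite lee_fin hyperbolic_density_ge0.
Qed.

(** Cut down to the disc because the formula can map outside points, such as its pole, into the
    disc. *)
Definition mobius_preimage (theta : R) (a : R[i]) (A : set R[i]) : set R[i] :=
  [set z | unit_disc z /\ A (mobius theta a z)].

Definition mobius_preimage_pair (theta : R) (a : R[i]) (B : set (RR * RR)) :
    set (RR * RR) :=
  pair_to_complex @^-1` mobius_preimage theta a (complex_to_pair @^-1` B).

(** The density, extended by 0 off B and the disc, is fed to the change of variables along F;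
    [mobius_density] then restores the density. *)
Lemma hyperbolic_pair_mobius (theta : R) (a : R[i]) (B : set (RR * RR)) :
  unit_disc a -> measurable B ->
  measurable (mobius_preimage_pair theta a B) /\
  hyperbolic_pair (mobius_preimage_pair theta a B) = hyperbolic_pair B.
Proof.
move=> a1 mB; have [F [j [[mF mj j0 HF] FE jE Fd]]] :=
  mobius_has_complex_jacobian theta a1.
have mdisc := measurable_disc_pair.
have mM : measurable (mobius_preimage_pair theta a B).
  rewrite (_ : mobius_preimage_pair theta a B = disc_pair `&`
      (complex_to_pair \o F \o pair_to_complex) @^-1` B).
    by apply: measurableI => //; rewrite -[X in measurable X]setTI; exact: mF.
  by apply/seteqP; split => p [p1] /=; rewrite ?FE// => Bp; split => //=;
    rewrite FE.
split => //; rewrite /hyperbolic_pair integral_mkcond [RHS]integral_mkcond.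
rewrite -[RHS]HF.
- apply: eq_integral => p _; rewrite !patchE /=.
  case: ifPn => [|h].
    rewrite inE => -[[p1 Bp] _].
    rewrite ifT; last by rewrite inE; split;
      rewrite /disc_pair /= ?complex_to_pairK FE//; exact: mobius_disc.
    by rewrite complex_to_pairK FE// jE// -EFinM mobius_density.
  rewrite ifF ?mul0e//; apply/negP; rewrite inE => -[BF dF].
  move/negP : h; apply; rewrite inE.
  have p1 : unit_disc (pair_to_complex p).
    by apply: Fd; move: dF; rewrite /disc_pair /= complex_to_pairK.
  by split => //; split => //=; rewrite -FE.
- apply/(measurable_restrictT _ _).1; first exact: measurableI.
  by apply: measurable_funTS; apply/measurable_EFinP;
    exact: measurable_density_pair.
- by move=> p; rewrite patchE; case: ifP => // _;
    rewrite lee_fin hyperbolic_density_ge0.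
Qed.

(** The density is at least 1 on the disc, so the hyperbolic measure dominates Lebesgue measure
    there. *)
Lemma hyperbolic_pair_null (N : set (RR * RR)) : measurable N ->
  N `<=` disc_pair -> hyperbolic_pair N = 0%E -> mu2 N = 0%E.
Proof.
move=> mN Nd N0; apply/eqP; rewrite eq_le measure_ge0 andbT -N0.
rewrite /hyperbolic_pair (setIidl Nd) -[leLHS]mul1e -integral_cst//.
apply: ge0_le_integral => //.
- by apply: measurable_funTS; apply/measurable_EFinP;
    exact: measurable_density_pair.
- move=> p /Nd pd; rewrite lee_fin /hyperbolic_density.
  have d0 : 0 < 1 - normc (pair_to_complex p) ^+ 2 by exact/unit_discP.
  rewrite invf_ge1 ?exprn_gt0//; apply: exprn_ile1 => //; first exact: ltW.
  by rewrite gerBl sqr_ge0.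
Qed.

Lemma null_hyperbolic_pair (N : set (RR * RR)) : measurable N ->
  mu2 N = 0%E -> hyperbolic_pair N = 0%E.
Proof.
move=> mN N0; have mNd : measurable (N `&` disc_pair).
  by apply: measurableI => //; exact: measurable_disc_pair.
apply: null_set_integral => //.
  by apply: measurable_funTS; apply/measurable_EFinP;
    exact: measurable_density_pair.
by apply: (subset_measure0 mNd mN) => //; exact: subIsetl.
Qed.

Lemma measurable_null_subset (N : set (RR * RR)) (A : set R[i]) :
  measurable N -> mu2 N = 0%E -> A `<=` complex_to_pair @^-1` N ->
  measurable (A : set (lebesgueC R)).
Proof.
move=> mN N0 AN.
apply: (@measure_is_complete_caratheodory _ _ (mu_ext mu2)).
exists N; split.
- exact: caratheodory_measurable_mu_ext.
- by rewrite -[RHS]N0; exact: measurable_mu_extE.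
- by move=> p /AN; case: p.
Qed.

(** Gives the finiteness required by the Borel sandwich; the disc lies in the square of side 2. *)
Lemma lebesgue_measureC_disc : (@lebesgue_measureC R unit_disc < +oo)%E.
Proof.
have mitv : measurable (`[(-1)%R, 1%R]%classic : set RR) by exact:
  measurable_itv.
have := @lebesgue_measureC_pair (`[(-1)%R, 1%R] `*` `[(-1)%R, 1%R])
  (measurableX mitv mitv).
rewrite product_measure1E// => H.
apply: (@le_lt_trans _ _ (mu `[(-1)%R, 1%R] * mu `[(-1)%R, 1%R])%E); last first.
  by rewrite lebesgue_measure_itv/=; case: ifP => _;
    rewrite -?EFinD -?EFinM ltry.
rewrite -H; apply: le_measure; rewrite ?inE.
- exact: measurable_unit_disc.
- by apply: measurable_preimage_pair; exact: measurableX.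
- move=> z; rewrite /unit_disc /mkset => z1.
  have : normc z ^+ 2 < 1 by rewrite expr_lt1// normc_ge0.
  by rewrite normc_sqr; case: z {z1} => x y /= h; split; rewrite /= in_itv/=;
    nra.
Qed.

Lemma hyperbolic_measure_mobius (theta : R) (a : R[i]) (A : set R[i]) :
  unit_disc a -> measurable (A : set (lebesgueC R)) ->
  measurable (mobius_preimage theta a A : set (lebesgueC R)) /\
  hyp (mobius_preimage theta a A) = hyp A.
Proof.
move=> a1; wlog AD : A / A `<=` unit_disc.
  move=> H mA; have := H (A `&` unit_disc) (@subIsetr _ _ _)
    (measurableI _ _ mA measurable_unit_disc).
  rewrite (_ : mobius_preimage theta a (A `&` unit_disc) = mobius_preimage
    theta a A); last first.
    apply/seteqP; split => z [z1]; first by case.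
    by move=> Az; split => //; split => //; exact: mobius_disc.
  by move=> [? ->]; split => //; rewrite /hyperbolic_measure -setIA setIid.
move=> mA.
have Aoo : (@lebesgue_measureC R A < +oo)%E.
  apply: le_lt_trans lebesgue_measureC_disc.
  by apply: le_measure; rewrite ?inE//; exact: measurable_unit_disc.
have [B [C [mB mC BA AC CB0]]] := caratheodory_sandwich mA Aoo.
have mN : measurable (C `\` B) by exact: measurableD.
have [mMB hMB] := hyperbolic_pair_mobius theta a1 mB.
have [mMC hMC] := hyperbolic_pair_mobius theta a1 mC.
have [mMN hMN] := hyperbolic_pair_mobius theta a1 mN.
(* Null for Lebesgue measure implies null for the hyperbolic one, which is invariant on Borel sets,
   and the converse implication holds within the disc. *)
have MN0 : mu2 (mobius_preimage_pair theta a (C `\` B)) = 0%E.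
  apply: hyperbolic_pair_null => //; first by move=> p [].
  by rewrite hMN; exact: null_hyperbolic_pair.
have BA' : complex_to_pair @^-1` B `<=` A by case=> x y; exact: (BA (x, y)).
have AC' : A `<=` complex_to_pair @^-1` C by case=> x y; exact: (AC (x, y)).
have MBA : complex_to_pair @^-1` (mobius_preimage_pair theta a B) `<=`
    mobius_preimage theta a A.
  by move=> z [] /=; rewrite complex_to_pairK => z1 /BA'.
have MAC : mobius_preimage theta a A `<=`
    complex_to_pair @^-1` (mobius_preimage_pair theta a C).
  by move=> z [z1 /AC' Cz]; split; rewrite /= complex_to_pairK.
(* The preimage of A is that of B together with a subset of a null Borel set, measurable by
   completeness. *)
have mMA : measurable (mobius_preimage theta a A : set (lebesgueC R)).
  rewrite -(setDUK MBA); apply: measurableU.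
    exact: measurable_preimage_pair.
  apply: (measurable_null_subset mMN MN0) => z [/[dup] -[z1 _] /MAC].
  rewrite /mobius_preimage_pair /preimage/= complex_to_pairK => -[_ Cz] Bz.
  by split => //; split => // Bz'; apply: Bz; split.
split => //.
have hBC : hyperbolic_pair C = hyperbolic_pair B.
  rewrite -!hyperbolic_measure_pair// -(setDUK (subset_trans BA AC)).
  rewrite preimage_setU measureU; first last.
  - by rewrite -preimage_setI setDIK preimage_set0.
  - exact: measurable_preimage_pair.
  - exact: measurable_preimage_pair.
  by rewrite [X in (_ + X)%E]hyperbolic_measure_pair// null_hyperbolic_pair//
    adde0.
have le_hyp (X Y : set (lebesgueC R)) : measurable X -> measurable Y ->
    X `<=` Y -> (hyp X <= hyp Y)%E.
  by move=> mX mY XY; apply: le_measure; rewrite ?inE.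
have mp := measurable_preimage_pair.
(* Both measures are squeezed between those of B and C, which coincide. *)
transitivity (hyperbolic_pair B); apply/eqP; rewrite eq_le; apply/andP; split.
- rewrite -hBC -hMC -hyperbolic_measure_pair//; apply: le_hyp => //; exact: mp.
- rewrite -hMB -hyperbolic_measure_pair//; apply: le_hyp => //; exact: mp.
- rewrite -hyperbolic_measure_pair//; apply: le_hyp => //; exact: mp.
- rewrite -hBC -hyperbolic_measure_pair//; apply: le_hyp => //; exact: mp.
Qed.

End invariance.

(** * Barycenters *)

Section barycenter.
Context {R : realType}.
Local Notation hyp := (@hyperbolic_measure R).

Lemma hyperbolic_measure_setI_disc (A : set R[i]) :
  hyp (A `&` unit_disc) = hyp A.
Proof. by rewrite /hyperbolic_measure -setIA setIid. Qed.

Lemma mobiusKV theta (a w : R[i]) : unit_disc a -> unit_disc w ->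
  mobius theta a (mobius (- theta) (cis theta * a) w) = w.
Proof.
move=> a1 w1; have := mobiusK (- theta) (unit_disc_cisM theta a1) w1.
by rewrite opprK cisN mulrA mulVf ?cis_neq0// mul1r.
Qed.

(** Turns images into preimages under the inverse map, to which invariance applies. *)
Lemma mobius_image theta (a : R[i]) (D : set R[i]) : unit_disc a ->
  D `<=` unit_disc ->
  mobius theta a @` D = mobius_preimage (- theta) (cis theta * a) D.
Proof.
move=> a1 D1; apply/seteqP; split => [_ [z Dz <-]|w [w1 Dw]].
  by split; [apply: mobius_disc => //; exact: D1|rewrite mobiusK//; exact: D1].
by eexists; [exact: Dw|exact: mobiusKV].
Qed.

Lemma mobius_preimage_image theta (a : R[i]) (D : set R[i]) : unit_disc a ->
  D `<=` unit_disc -> mobius_preimage theta a (mobius theta a @` D) = D.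
Proof.
move=> a1 D1; apply/seteqP; split => [z [z1 [w Dw wz]]|z Dz].
  by rewrite -(mobiusK theta a1 z1) -wz mobiusK//; exact: D1.
by split; [exact: D1|exists z].
Qed.

Section pushforward_mobius.
Context (theta : R) (a : R[i]) (a1 : unit_disc a).

(** A total map, as a pushforward requires; it is the identity off the disc, where the hyperbolic
    measure has no mass. *)
Definition mobius_ext (z : lebesgueC R) : lebesgueC R :=
  if `[< unit_disc z >] then mobius theta a z else z.

Lemma mobius_ext_preimage (A : set R[i]) : mobius_ext @^-1` A =
  mobius_preimage theta a A `|` (A `\` unit_disc).
Proof.
apply/seteqP; split => z; rewrite /preimage/= /mobius_ext.
  by case: asboolP => z1 Az; [left|right].
by move=> [[z1 Az]|[Az z1]]; case: asboolP.
Qed.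

Lemma measurable_mobius_ext : measurable_fun setT mobius_ext.
Proof.
move=> _ A mA; rewrite setTI mobius_ext_preimage; apply: measurableU.
  by have [] := hyperbolic_measure_mobius theta a1 mA.
by apply: measurableD => //; exact: measurable_unit_disc.
Qed.

Lemma hyperbolic_measure_mobius_ext (A : set (lebesgueC R)) : measurable A ->
  hyp (mobius_ext @^-1` A) = hyp A.
Proof.
move=> mA; have [_ <-] := hyperbolic_measure_mobius theta a1 mA.
rewrite mobius_ext_preimage -hyperbolic_measure_setI_disc.
rewrite -[RHS]hyperbolic_measure_setI_disc; congr (hyp _).
by apply/seteqP; split => z [h z1]; split => //; [case: h => // -[]|left].
Qed.

(** Invariance says that [mobius_ext] pushes the measure to itself, which settles nonnegative
    functions; positive and negative parts commute with composition. *)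
Lemma integral_mobius (E : set (lebesgueC R)) (f : lebesgueC R -> \bar R) :
  measurable E -> E `<=` unit_disc -> measurable_fun E f ->
  (\int[hyp]_(z in E) f z =
   \int[hyp]_(z in mobius_preimage theta a E) f (mobius theta a z))%E.
Proof.
move=> mE E1 mf.
have preE : mobius_ext @^-1` E = mobius_preimage theta a E.
  rewrite mobius_ext_preimage (_ : E `\` unit_disc = set0) ?setU0//.
  by apply/seteqP; split => z // [/E1].
have push (h : lebesgueC R -> \bar R) : measurable_fun E h ->
    (forall z, (0 <= h z)%E) ->
    (\int[hyp]_(z in E) h z =
     \int[hyp]_(z in mobius_preimage theta a E) h (mobius theta a z))%E.
  move=> mh h0; transitivity (\int[pushforward hyp mobius_ext]_(z in E) h z)%E.
    symmetry; apply: (@eq_measure_integral _ _ _ _ hyp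
      (pushforward_measure
        hyp measurable_mobius_ext)).
    by move=> X mX _; exact: hyperbolic_measure_mobius_ext.
  rewrite (ge0_integral_pushforward measurable_mobius_ext)// preE.
  apply: eq_integral => z; rewrite inE => -[z1 _] /=.
  by rewrite /mobius_ext asboolT.
rewrite integralE [RHS]integralE; congr (_ - _)%E.
- rewrite (funepos_comp f (mobius theta a)).
  by apply: (push f^\+%E) => [|z];
    [exact: measurable_funepos|exact: funepos_ge0].
- rewrite (funeneg_comp f (mobius theta a)).
  by apply: (push f^\-%E) => [|z];
    [exact: measurable_funeneg|exact: funeneg_ge0].
Qed.

End pushforward_mobius.

(** On the disc [blaschke c] is the Möbius map of angle 0, hence agrees with a map F that is Borel
    by its Jacobian property. *)
Lemma measurable_blaschke (c : R[i]) (D : set (lebesgueC R)) :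
  unit_disc c -> D `<=` unit_disc -> measurable D ->
  measurable_fun D (fun z : lebesgueC R => complex.Re (blaschke c z)) /\
  measurable_fun D (fun z : lebesgueC R => complex.Im (blaschke c z)).
Proof.
move=> c1 D1 mD; have [F [j [[mF _ _ _] FE _ _]]] :=
  mobius_has_complex_jacobian 0 c1.
have mT : measurable_fun D ((complex_to_pair \o F \o pair_to_complex) \o
    (complex_to_pair : lebesgueC R -> _)).
  by apply: measurable_funTS; apply: measurableT_comp mF _;
    exact: measurable_complex_to_pair.
split.
- apply: (eq_measurable_fun _ _ (measurableT_comp measurable_fst mT)).
  by move=> z /set_mem/D1 z1; rewrite /= complex_to_pairK FE// blaschkeE.
- apply: (eq_measurable_fun _ _ (measurableT_comp measurable_snd mT)).
  by move=> z /set_mem/D1 z1; rewrite /= complex_to_pairK FE// blaschkeE.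
Qed.

Lemma integrable_blaschke (c : R[i]) (D : set R[i]) :
  unit_disc c -> admissible D ->
  hyp.-integrable D (fun z : lebesgueC R => (complex.Re (blaschke c z))%:E) /\
  hyp.-integrable D (fun z : lebesgueC R => (complex.Im (blaschke c z))%:E).
Proof.
move=> c1 [D1 mD /andP[_ Doo]].
have [mRe mIm] := measurable_blaschke c1 D1 mD.
have le1 (z : R[i]) : D z -> complex.Re (blaschke c z) ^+ 2 + complex.Im
  (blaschke c z) ^+ 2 <= 1.
  move=> /D1 z1; rewrite -normc_sqr blaschkeE ltW// expr_lt1// ?normc_ge0//.
  exact: mobius_disc.
split; apply: (measurable_bounded_integrable mD Doo) => //.
- exists 1; split; first exact: num_real.
  move=> M M1 z /= /le1 h; rewrite (le_trans _ (ltW M1))//.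
  by rewrite -(@expr_le1 _ 2)// real_normK ?num_real//; apply: le_trans h;
    rewrite lerDl sqr_ge0.
- exists 1; split; first exact: num_real.
  move=> M M1 z /= /le1 h; rewrite (le_trans _ (ltW M1))//.
  by rewrite -(@expr_le1 _ 2)// real_normK ?num_real//; apply: le_trans h;
    rewrite lerDr sqr_ge0.
Qed.

(** Multiplication by w mixes real and imaginary parts, so both must be integrable for real
    linearity to apply. *)
Lemma CintegralZl d (T : measurableType d) (m : {measure set T -> \bar R})
    (D : set T) (w : R[i]) (f : T -> R[i]) : measurable D ->
  m.-integrable D (fun x => (complex.Re (f x))%:E) ->
  m.-integrable D (fun x => (complex.Im (f x))%:E) ->
  Cintegral m D (fun x => w * f x) = w * Cintegral m D f.
Proof.
move=> mD iRe iIm; case: w => u v; rewrite /Cintegral.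
have iZ (r : R) (h : T -> R) : m.-integrable D (EFin \o h) ->
    m.-integrable D (EFin \o (fun x => r * h x)).
  by move=> ih; apply: (eq_integrable mD _ _ _ (integrableZl mD r ih)).
apply/eqP; rewrite eq_complex /=; apply/andP; split; apply/eqP.
- rewrite -!RintegralZl// -RintegralB//; try exact: iZ.
  by apply: eq_Rintegral => x _; case: (f x).
- rewrite -!RintegralZl// -RintegralD//; try exact: iZ.
  by apply: eq_Rintegral => x _; case: (f x).
Qed.

Lemma admissible_mobius theta (a : R[i]) (D : set R[i]) :
  unit_disc a -> admissible D -> admissible (mobius theta a @` D).
Proof.
move=> a1 [D1 mD D0]; have a1' := unit_disc_cisM theta a1.
have [mE hE] := hyperbolic_measure_mobius (- theta) a1' mD.
by split; rewrite ?mobius_image// ?hE// => z [].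
Qed.

Lemma balanced_mobius theta (a c : R[i]) (D : set R[i]) :
  unit_disc a -> admissible D -> unit_disc c ->
  balanced (mobius theta a @` D) (mobius theta a c) <-> balanced D c.
Proof.
move=> a1 hD c1; have [D1 mD _] := hD.
have [E1 mE _] := admissible_mobius theta a1 hD.
have gc1 := mobius_disc theta a1 c1.
pose w := - cis theta * ((1 - a * conjc c) / (1 - conjc a * c)).
have w0 : w != 0.
  rewrite /w !mulf_neq0 ?oppr_eq0 ?cis_neq0 ?invr_eq0 ?denom_neq0//.
  by rewrite mulrC denom_neq0.
have [mRe mIm] := measurable_blaschke gc1 E1 mE.
have wE z : D z -> blaschke (mobius theta a c) (mobius theta a z) = w *
  blaschke c z.
  by move=> /D1 z1; rewrite blaschke_mobius.
(* Invariance brings the integral back to D, and the equivariance [wE] lets the constant w out. *)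
have CE : Cintegral hyp (mobius theta a @` D)
      (fun z : lebesgueC R => blaschke (mobius theta a c) z) =
    w * Cintegral hyp D (fun z : lebesgueC R => blaschke c z).
  have [iRe iIm] := integrable_blaschke c1 hD.
  rewrite -CintegralZl// /Cintegral /Rintegral.
  rewrite (integral_mobius theta a1 mE E1)//; last exact/measurable_EFinP.
  rewrite (integral_mobius theta a1 mE E1)//; last exact/measurable_EFinP.
  rewrite mobius_preimage_image//.
  by congr (fine _ +i* fine _); apply: eq_integral => z /set_mem Dz; rewrite wE.
rewrite /balanced; split => -[_ H]; split => //.
- by apply: (mulfI w0); rewrite mulr0 -[RHS]H -CE.
- by rewrite -[LHS]/(Cintegral hyp _ (fun z : lebesgueC R => blaschke _ z)) CE
    -[X in w * X]/(Cintegral hyp _ (fun z : lebesgueC R => _)) H mulr0.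
Qed.

End barycenter.

Theorem theorem1p7 (R : realType) (D : set R[i]) (c : R[i])
    (hD : admissible D) (hc : conformal_barycenter D c)
    (g : R[i] -> R[i]) (hg : Gplus g) :
  conformal_barycenter (g @` D) (g c).
Proof.
have [theta [a [_ a1 gE]]] := hg; have [_ [bc uc]] := hc.
have [D1 _ _] := hD; have [c1 _] := bc.
(* The values of g are known on the disc only, and D lies in it. *)
have -> : g @` D = mobius theta a @` D by apply: eq_imagel => z /D1; exact: gE.
rewrite gE//; split; first exact: admissible_mobius.
split; first exact/balanced_mobius.
(* Uniqueness: w is the image of its preimage v in the disc; v is balanced for D, hence equal to
   c. *)
move=> w bw; have [w1 _] := bw.
have a1' := unit_disc_cisM theta a1.
have v1 := mobius_disc (- theta) a1' w1.
have [+ _] := balanced_mobius theta a1 hD v1.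
by rewrite mobiusKV// => /(_ bw)/uc ->; rewrite mobiusKV.
Qed.
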